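(* Let $c>0$ and let $\mathcal{N}$ be a set of positive integers such that for each $N \in \mathcal{N}$ there exist an abelian group $\Gamma_N$ of order $N$ and a $3$-fold Sidon set $A_N \subseteq \Gamma_N$ with $|A_N| \geq c\sqrt{N}$. Then for each $N \in \mathcal{N}$ there exists a graph $G_N$ on $4N$ vertices with $\Theta(N^{3/2})$ edges (with implied constants independent of $N$) such that every edge of $G_N$ is contained in exactly one cycle of length four of $G_N$.
   Context: A set $A$ in an abelian group $\Gamma$ is a $k$-fold Sidon set if, for all integers $\alpha,\beta,\gamma,\delta$ with $\alpha+\beta = \gamma+\delta$ and $1 \leq \alpha,\beta,|\gamma|,|\delta| \leq k$, every solution of $\alpha a + \beta b = \gamma c + \delta d$ with $a,b,c,d \in A$ satisfies $\{a,b\} = \{c,d\}$. *)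

(* Defs.v *)
From HB Require Import structures.
From mathcomp Require Import all_boot all_order all_algebra.
From mathcomp Require Import all_classical reals exp.

Set Implicit Arguments.
Unset Strict Implicit.
Unset Printing Implicit Defensive.

Import Order.TTheory GRing.Theory Num.Theory.

Local Open Scope ring_scope.

(* The conclusion is an equality of sets, not of multisets. *)
Definition fold_sidon (k : nat) (Gamma : zmodType) (A : set Gamma) : Prop :=
  forall alpha beta gamma delta : int,
    alpha + beta = gamma + delta ->
    1 <= alpha <= k%:Z -> 1 <= beta <= k%:Z ->
    1 <= `|gamma| <= k%:Z -> 1 <= `|delta| <= k%:Z ->
  forall a b c d : Gamma, A a -> A b -> A c -> A d ->
    a *~ alpha + b *~ beta = c *~ gamma + d *~ delta ->
    [set a; b]%classic = [set c; d]%classic.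

Record sgraph (V : finType) := SGraph {
  adj :> rel V;
  adj_sym : symmetric adj;
  adj_irrefl : irreflexive adj
}.

Definition edges (V : finType) (G : sgraph V) : {set {set V}} :=
  [set [set p.1; p.2]%SET | p : V * V & G p.1 p.2]%SET.

(* A cycle, as a subgraph, is determined by its edge set; this identifies the
   different starting points and orientations of the same cycle. *)
Definition cycle_edges (V : finType) (s : seq V) : {set {set V}} :=
  [set [set x; next s x]%SET | x in s]%SET.

Definition four_cycle (V : finType) (G : sgraph V) (C : {set {set V}}) : Prop :=
  exists s : 4.-tuple V, ucycle G s /\ C = cycle_edges s.

(* Main.v *)
(* Take four copies of Gamma, numbered 0, 1, 2, 3, and for every x in Gamma and
   a in A the square on the vertices (i, x + i a), where copies 0 and 1 are
   joined to copies 2 and 3.  The differences j - i along the edges at a given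
   copy i have one sign and distinct absolute values at most 3, so the 3-fold
   Sidon property gives two vertices of the same copy at most one common
   neighbour.  Hence a 4-cycle meets all four copies; walking around it gives a
   relation between the four elements of A on its edges, and the Sidon property
   forces these to be equal.  So the 4-cycles are the squares, and an edge
   determines its x and a.  There are about N |A| edges, and |A|^2 <= N because
   a + 2 b determines a and b. *)
Require Import Defs.
From HB Require Import structures.
From mathcomp Require Import all_boot all_order all_algebra.
From mathcomp Require Import all_classical reals exp.
From mathcomp Require Import zify lra.

Set Implicit Arguments.
Unset Strict Implicit.
Unset Printing Implicit Defensive.

Import Order.TTheory GRing.Theory Num.Theory.

Local Open Scope ring_scope.

(** * Integer multiples, and 4-cycles as edge sets *)

Lemma mulrz_cross (V : zmodType) (a c : V) (k1 k2 k3 k4 : int) :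
    k1 + k2 = k3 + k4 -> a *~ k1 + c *~ k2 = a *~ k3 + c *~ k4 ->
  a *~ (k1 - k3) = c *~ (k1 - k3).
Proof.
move=> ek e; have {2}-> : k1 - k3 = k4 - k2 by lia.
apply/eqP; rewrite !mulrzBr.
by rewrite subr_eq addrAC [c *~ _ + _]addrC -e addrK.
Qed.

Lemma cycle_edges4 (T : finType) (x0 x1 x2 x3 : T) :
    uniq [:: x0; x1; x2; x3] ->
  cycle_edges [:: x0; x1; x2; x3] =
    [set [set x0; x1]; [set x1; x2]; [set x2; x3]; [set x3; x0]]%SET.
Proof.
set s := [:: x0; x1; x2; x3].
rewrite /= !inE !negb_or -!andbA => /and5P[n01 n02 n03 n12 /and3P[n13 n23 _]].
have next0 : next s x0 = x1 by rewrite /= eqxx.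
have next1 : next s x1 = x2 by rewrite /= eq_sym (negPf n01) eqxx.
have next2 : next s x2 = x3.
  by rewrite /= eq_sym (negPf n02) eq_sym (negPf n12) eqxx.
have next3 : next s x3 = x0.
  by rewrite /= eq_sym (negPf n03) eq_sym (negPf n13) eq_sym (negPf n23) eqxx.
apply/setP=> f; rewrite !inE -!orbA; apply/imsetP/or4P => [[x]|].
  by rewrite !inE => /or4P[] /eqP -> ->; rewrite ?(next0, next1, next2, next3);
    [apply: Or41|apply: Or42|apply: Or43|apply: Or44].
by case=> /eqP ->; [exists x0|exists x1|exists x2|exists x3];
  rewrite ?(next0, next1, next2, next3) // !inE eqxx ?orbT.
Qed.

(** * Consequences of the 3-fold Sidon property *)

Section Sidon.
Variables (Gamma : finZmodType) (A : {set Gamma}).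
Hypothesis sidonA : fold_sidon 3 [set x : Gamma | x \in A]%classic.

(** Two negative coefficients on the left are made positive by negating the equation. An equality of
    sets leaves just two ways to match the elements. *)
Lemma sidon_eq (k1 k2 k3 k4 : int) (a b c d : Gamma) :
    k1 + k2 = k3 + k4 -> (0 < k1) = (0 < k2) ->
    1 <= `|k1| <= 3 -> 1 <= `|k2| <= 3 -> 1 <= `|k3| <= 3 -> 1 <= `|k4| <= 3 ->
    a \in A -> b \in A -> c \in A -> d \in A ->
    a *~ k1 + b *~ k2 = c *~ k3 + d *~ k4 ->
  a = c /\ b = d \/ a = d /\ b = c.
Proof.
move=> ek sk h1 h2 h3 h4 Aa Ab Ac Ad e.
have eqs : [set a; b]%classic = [set c; d]%classic.
  have [k1_gt0|k1_le0] := boolP (0 < k1).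
    by apply: (sidonA ek _ _ h3 h4 Aa Ab Ac Ad e); lia.
  apply: (@sidonA (- k1) (- k2) (- k3) (- k4)) => //; try lia.
  by rewrite !mulrNz -!opprD e.
have ha : [set c; d]%classic a by rewrite -eqs; left.
have hb : [set c; d]%classic b by rewrite -eqs; right.
have hc : [set a; b]%classic c by rewrite eqs; left.
have hd : [set a; b]%classic d by rewrite eqs; right.
case: ha hb hc hd => /= -> [] -> [] hc [] hd;
  by [left; split; congruence | right; split; congruence].
Qed.

Lemma sidon_torsion (k : int) (a b : Gamma) :
  1 <= `|k| <= 3 -> a \in A -> b \in A -> a *~ k = b *~ k -> a = b.
Proof.
move=> hk Aa Ab e.
(* Doubling gives a relation with four coefficients [k], so the sets [{a, a}] and [{b, b}] agree. *)
have eaa : a *~ k + a *~ k = b *~ k + b *~ k by rewrite e.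
by case: (sidon_eq erefl erefl hk hk hk hk Aa Aa Ab Ab eaa) => -[].
Qed.

Lemma sidon_pair (k l : int) (a b c d : Gamma) :
    (0 < k) = (0 < l) -> 1 <= `|k| <= 3 -> 1 <= `|l| <= 3 ->
    a \in A -> b \in A -> c \in A -> d \in A ->
    a *~ k + b *~ l = c *~ k + d *~ l ->
  a = c /\ b = d \/ [/\ k = l, a = d & b = c].
Proof.
move=> skl hk hl Aa Ab Ac Ad e.
have [|[ad bc]] := sidon_eq erefl skl hk hl hk hl Aa Ab Ac Ad e; first by left.
have [->|nkl] := eqVneq k l; first by right.
(* After a swap with [k != l], the relation reduces to [a *~ (k - l) = c *~ (k - l)]. As [k] and [l]
   have one sign, their difference is at most 2 in absolute value. *)
suff ac : a = c by left; rewrite -ac -ad bc ac.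
apply: (@sidon_torsion (k - l)) => //; first by lia.
rewrite -ad bc in e; apply/eqP.
by rewrite !mulrzBr subr_eq addrAC -e addrK.
Qed.

Lemma sidon_card : (#|A| ^ 2 <= #|Gamma|)%N.
Proof.
rewrite -mulnn -cardsX -(@card_in_imset _ _ (fun p => p.1 + p.2 *~ 2)).
  exact: max_card.
move=> [a b] [c d] /setXP[/= Aa Ab] /setXP[/= Ac Ad] e.
(* The coefficients 1 and 2 differ, which rules out the swap. *)
by have [[-> ->]|[]] := @sidon_pair 1 2 a b c d erefl erefl erefl Aa Ab Ac Ad e.
Qed.

(** * The graph on four copies of the group *)

Definition side (i : 'I_4) : bool := (i < 2)%N.

Definition gap (i j : 'I_4) : int := i%:Z - j%:Z.

Lemma gap_bound (i j : 'I_4) : i != j -> 1 <= `|gap i j| <= 3.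
Proof. rewrite -val_eqE /gap /=; have := ltn_ord i; have := ltn_ord j; lia. Qed.

Lemma side_neq (i j : 'I_4) : side i (+) side j -> i != j.
Proof. by apply: contraL => /eqP ->; rewrite addbb. Qed.

(** Copies 0 and 1 come before 2 and 3, so the sign depends only on the side of [i]. This supplies
    the sign condition of [sidon_eq]. *)
Lemma gap_gt0 (i j : 'I_4) : side i (+) side j -> (0 < gap i j) = ~~ side i.
Proof. rewrite /side /gap; have := ltn_ord i; have := ltn_ord j; lia. Qed.

Lemma gap_subr (i j l : 'I_4) : gap i j - gap l j = gap i l.
Proof. by rewrite /gap; lia. Qed.

Lemma gap_subl (i j l : 'I_4) : gap i l - gap i j = gap j l.
Proof. by rewrite /gap; lia. Qed.

Lemma gap_cross (i j l m : 'I_4) : gap i j + gap l m = gap l j + gap i m.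
Proof. by rewrite /gap; lia. Qed.

(** Passes from the difference along an edge to the base point that its two ends share. *)
Lemma sub_mulrz_gap (a x y : Gamma) (i j : 'I_4) :
  (x - y = a *~ gap i j) <-> (x - a *~ i%:Z = y - a *~ j%:Z).
Proof.
rewrite /gap mulrzBr; split=> /eqP; rewrite subr_eq => /eqP ->.
  by rewrite -addrA addrC subrKA.
by rewrite [y - _]addrC [LHS]addrAC addrK addrC.
Qed.

Definition sidon_rel : rel ('I_4 * Gamma) := fun u v =>
  (side u.1 (+) side v.1) &&
  [exists a in A, u.2 - v.2 == a *~ gap u.1 v.1].

Lemma sidon_relP (u v : 'I_4 * Gamma) :
  reflect (side u.1 (+) side v.1 /\
           exists2 a, a \in A & u.2 - v.2 = a *~ gap u.1 v.1)
          (sidon_rel u v).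
Proof.
apply: (iffP andP) => [[s /exists_inP[a Aa /eqP e]]|[s [a Aa e]]]; split=> //.
  by exists a.
by apply/exists_inP; exists a => //; apply/eqP.
Qed.

Lemma sidon_rel_sym : symmetric sidon_rel.
Proof.
suff sub u v : sidon_rel u v -> sidon_rel v u
  by move=> u v; apply/idP/idP; apply: sub.
case/sidon_relP=> s [a Aa e]; apply/sidon_relP; split; first by rewrite addbC.
by exists a => //; rewrite -opprB e -mulrNz /gap opprB.
Qed.

Lemma sidon_rel_irrefl : irreflexive sidon_rel.
Proof. by move=> u; rewrite /sidon_rel addbb. Qed.

Definition sidon_graph : sgraph ('I_4 * Gamma)%type :=
  SGraph sidon_rel_sym sidon_rel_irrefl.

(** Apply [sidon_pair] to [(u - y) + (v - z) = (v - y) + (u - z)]. Either the edges from [u] and [v]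
    to [y] carry the same element of [A], so [u = v], or [y] and [z] lie in the same copy and the
    edges from [u] to them carry the same element. *)
Lemma common_neighbor_unique (u v y z : 'I_4 * Gamma) :
    u.1 = v.1 -> u <> v ->
    sidon_rel u y -> sidon_rel v y -> sidon_rel u z -> sidon_rel v z ->
  y = z.
Proof.
case: u v y z => [i u] [i' v] [j y] [l z] /= ii'; subst i' => uv.
case/sidon_relP=> /= sj [a Aa ea] /sidon_relP[_ /= [b Ab eb]].
case/sidon_relP=> /= sl [c Ac ec] /sidon_relP[_ /= [d Ad ed]].
have eq_gap : (0 < gap i j) = (0 < gap i l) by rewrite !gap_gt0.
have e : a *~ gap i j + d *~ gap i l = b *~ gap i j + c *~ gap i l.
  by rewrite -ea -eb -ec -ed addrACA [RHS]addrACA [u + v]addrC.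
have [[ab _]|[kl ac _]] :=
    sidon_pair eq_gap (gap_bound (side_neq sj)) (gap_bound (side_neq sl))
      Aa Ad Ab Ac e.
  by case: uv; rewrite -[u](subrK y) ea ab -eb subrK.
have -> : j = l by apply/val_inj; move: kl; rewrite /gap => kl /=; lia.
by congr pair; rewrite -[y](subKr u) ea kl ac -ec subKr.
Qed.

(** * Squares and their identification with the 4-cycles *)

Definition block (x a : Gamma) (i : 'I_4) : 'I_4 * Gamma := (i, x + a *~ i%:Z).

(** Given as a set of edges, to be compared with [cycle_edges]: the complete bipartite graph between
    two pairs of vertices is a 4-cycle. *)
Definition square (x a : Gamma) : {set {set 'I_4 * Gamma}} :=
  [set [set block x a p.1; block x a p.2]%SET
     | p : 'I_4 * 'I_4 & side p.1 (+) side p.2]%SET.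

Lemma block_rel (x a : Gamma) (i j : 'I_4) :
  a \in A -> side i (+) side j -> sidon_rel (block x a i) (block x a j).
Proof.
move=> Aa sij; apply/sidon_relP; split=> //; exists a => //=.
by rewrite [x + _]addrC addrKA mulrzBr.
Qed.

Lemma rel_block (u v : 'I_4 * Gamma) :
  sidon_rel u v ->
  exists x a, [/\ a \in A, u = block x a u.1 & v = block x a v.1].
Proof.
case: u v => [i u] [j v] /sidon_relP[/= _ [a Aa e]].
exists (u - a *~ i%:Z), a; split=> //; rewrite /block; congr pair.
  by rewrite subrK.
by move/sub_mulrz_gap: e => ->; rewrite subrK.
Qed.

Lemma block_inj (x a y b : Gamma) (i j : 'I_4) :
    a \in A -> b \in A -> side i (+) side j ->
    block x a i = block y b i -> block x a j = block y b j ->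
  x = y /\ a = b.
Proof.
move=> Aa Ab sij [ei] [ej].
have ab : a = b.
  apply: (sidon_torsion (gap_bound (side_neq sij)) Aa Ab).
  by rewrite !mulrzBr -(addrKA x) [_ + x]addrC ei ej [y + _]addrC addrKA.
by split=> //; apply: (@addIr _ (a *~ i%:Z)); rewrite ei ab.
Qed.

Lemma four_cycle_block (x0 x1 x2 x3 : 'I_4 * Gamma) :
    x0.1 != x2.1 -> x1.1 != x3.1 ->
    sidon_rel x0 x1 -> sidon_rel x1 x2 -> sidon_rel x2 x3 -> sidon_rel x3 x0 ->
  exists x a, [/\ a \in A, x0 = block x a x0.1, x1 = block x a x1.1,
                  x2 = block x a x2.1 & x3 = block x a x3.1].
Proof.
case: x0 x1 x2 x3 => [i0 x0] [i1 x1] [i2 x2] [i3 x3] /= n02 n13.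
(* Every edge is read from [x0] or [x2], which lie on one side, so all four gaps have the same
   sign. *)
rewrite [sidon_rel (i1, _) _]sidon_rel_sym [sidon_rel (i3, _) _]sidon_rel_sym.
case/sidon_relP=> /= s01 [a Aa ea] /sidon_relP[/= s21 [b Ab eb]].
case/sidon_relP=> /= s23 [c Ac ec] /sidon_relP[/= s03 [d Ad ed]].
have eq_sgn : (0 < gap i0 i1) = (0 < gap i2 i3).
  by rewrite !gap_gt0 //; move: s01 s21; do 3!case: (side _).
have e : a *~ gap i0 i1 + c *~ gap i2 i3 = b *~ gap i2 i1 + d *~ gap i0 i3.
  by rewrite -ea -eb -ec -ed addrACA [RHS]addrACA [x2 + x0]addrC.
have gapb i j (s : side i (+) side j) := gap_bound (side_neq s).
have h := sidon_eq (gap_cross i0 i1 i2 i3) eq_sgn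
  (gapb _ _ s01) (gapb _ _ s23) (gapb _ _ s21) (gapb _ _ s03) Aa Ac Ab Ad e.
(* In either matching only [a] and [c] remain, and [mulrz_cross] leaves a relation with coefficient
   [gap i0 i2] or [gap i1 i3]. It is nonzero because opposite vertices lie in different copies. *)
have ac : a = c.
  case: h => -[h1 h2]; [apply: (sidon_torsion (gap_bound n02) Aa Ac)
                   |apply: (sidon_torsion (gap_bound n13) Aa Ac)].
    rewrite -(gap_subr i0 i1 i2).
    by apply: mulrz_cross (gap_cross i0 i1 i2 i3) _; rewrite e -h1 -h2.
  rewrite -(gap_subl i0 i1 i3).
  apply: mulrz_cross (etrans (gap_cross i0 i3 i2 i1) (addrC _ _)) _.
  by rewrite e -h1 -h2 addrC.
have ba : b = a by case: h => -[]; congruence.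
rewrite ba in eb; rewrite -ac in ec.
(* With one common element [a], adjacent vertices have equal base points, so all four have the base
   point of [x0]. *)
move/sub_mulrz_gap: ea => ea; move/sub_mulrz_gap: eb => eb.
move/sub_mulrz_gap: ec => ec.
exists (x0 - a *~ i0%:Z), a; rewrite /block subrK; split=> //; congr pair.
- by rewrite ea subrK.
- by rewrite ea -eb subrK.
- by rewrite ea -eb ec subrK.
Qed.

Lemma cycle_edges_block (x a : Gamma) (i0 i1 i2 i3 : 'I_4) :
    i0 != i2 -> i1 != i3 -> side i0 (+) side i1 -> side i1 (+) side i2 ->
    side i2 (+) side i3 ->
  cycle_edges [:: block x a i0; block x a i1; block x a i2; block x a i3] =
    square x a.
Proof.
move=> n02 n13 s01 s12 s23.
have s30 : side i3 (+) side i0.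
  by move: s01 s12 s23; do 4!case: (side _).
have ui : uniq [:: i0; i1; i2; i3].
  rewrite /= !inE !negb_or n02 n13 (side_neq s01) (side_neq s12) (side_neq s23).
  by rewrite eq_sym (side_neq s30).
rewrite cycle_edges4; last by apply: (@map_uniq _ _ fst).
(* Four distinct indices exhaust ['I_4], so every edge of the square joins two vertices of the
   cycle. *)
have cover i : i \in [:: i0; i1; i2; i3].
  have /(uniq_min_size ui) : {subset [:: i0; i1; i2; i3] <= enum 'I_4}.
    by move=> j _; rewrite mem_enum.
  rewrite size_enum_ord => -[] // _ ->; by rewrite mem_enum.
apply/setP=> f; rewrite !inE -!orbA; apply/or4P/imsetP => [|[[i j]]].
  by case=> /eqP ->;
    [exists (i0, i1)|exists (i1, i2)|exists (i2, i3)|exists (i3, i0)];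
    rewrite ?inE.
rewrite inE /= => sij ->.
have := cover i; have := cover j; rewrite !inE.
case/or4P=> /eqP ej /or4P[] /eqP ei; subst i j;
  solve [ by move: sij s01 s12 s23; do 4!case: (side _)
        | by apply: Or41 | by apply: Or42 | by apply: Or43 | by apply: Or44
        | by apply: Or41; rewrite finset.setUC
        | by apply: Or42; rewrite finset.setUC
        | by apply: Or43; rewrite finset.setUC
        | by apply: Or44; rewrite finset.setUC ].
Qed.

Lemma four_cycle_sidonP (C : {set {set 'I_4 * Gamma}}) :
  four_cycle sidon_graph C <-> exists x a, a \in A /\ C = square x a.
Proof.
split=> [[s [cs ->]]|[x [a [Aa ->]]]]; last first.
  (* The order 0, 2, 1, 3 alternates between the two sides. *)
  pose s := [:: ord0; inord 2; inord 1; inord 3] : seq 'I_4.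
  exists [tuple of map (block x a) s]; split; last first.
    by rewrite /= cycle_edges_block // /side -?val_eqE /= !inordK.
  apply/andP; split; first by rewrite /= !block_rel // /side /= ?inordK.
  apply: (@map_uniq _ _ fst).
  by rewrite /= !inE -!val_eqE /= !inordK.
case: s cs => [[|x0 [|x1 [|x2 [|x3 []]]]]] //= _ /andP[].
case/and5P=> e01 e12 e23 e30 _.
rewrite /= !inE !negb_or -!andbA => /and5P[_ n02 _ _ /and3P[n13 _ _]].
have sym u v : sidon_rel u v -> sidon_rel v u by rewrite sidon_rel_sym.
(* If [x0] and [x2] were in one copy, their common neighbours [x1] and [x3] would coincide. *)
have p02 : x0.1 != x2.1.
  apply: contra_neqN n13 => /eqP e; apply: (common_neighbor_unique e); auto.
  exact/eqP.
have p13 : x1.1 != x3.1.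
  apply: contra_neqN n02 => /eqP e; apply: (common_neighbor_unique e); auto.
  exact/eqP.
have [x [a [Aa b0 b1 b2 b3]]] := four_cycle_block p02 p13 e01 e12 e23 e30.
exists x, a; split=> //; rewrite b0 b1 b2 b3 cycle_edges_block //.
- by case/andP: e01.
- by case/andP: e12.
- by case/andP: e23.
Qed.

Lemma mem_edgesP (f : {set 'I_4 * Gamma}) :
  reflect (exists x a, a \in A /\ f \in square x a) (f \in edges sidon_graph).
Proof.
apply: (iffP imsetP) => [[[u v]]|[x [a [Aa /imsetP[[i j]]]]]]; rewrite inE /=.
  move=> uv ->; have [x [a [Aa -> ->]]] := rel_block uv.
  exists x, a; split=> //; apply/imsetP; exists (u.1, v.1) => //.
  by rewrite inE; case/andP: uv.
move=> sij ->; exists (block x a i, block x a j) => //.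
by rewrite inE block_rel.
Qed.

Lemma square_inj (x a y b : Gamma) (f : {set 'I_4 * Gamma}) :
  a \in A -> b \in A -> f \in square x a -> f \in square y b -> x = y /\ a = b.
Proof.
move=> Aa Ab /imsetP[[i j]]; rewrite inE /= => sij -> /imsetP[[k l] _ /= e].
(* The first coordinate names the copy, so an end of the shared edge is the vertex of the same index
   in both squares. Two such ends determine the square by [block_inj]. *)
have same m : block x a m \in [set block x a i; block x a j]%SET ->
    block x a m = block y b m.
  by rewrite e !inE => /orP[] /eqP h; rewrite h; case: h => ->.
by apply: (block_inj Aa Ab sij); apply: same; rewrite !inE eqxx ?orbT.
Qed.

Lemma edges_unique_four_cycle (f : {set 'I_4 * Gamma}) :
  f \in edges sidon_graph ->
  exists! C : {set {set 'I_4 * Gamma}}, four_cycle sidon_graph C /\ f \in C.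
Proof.
case/mem_edgesP=> x [a [Aa fx]]; exists (square x a); split.
  by split=> //; apply/four_cycle_sidonP; exists x, a.
move=> C [/four_cycle_sidonP[y [b [Ab ->]]] fy].
by have [-> ->] := square_inj Aa Ab fx fy.
Qed.

(** * Number of edges *)

Lemma card_edges_ge : (#|Gamma| * #|A| <= #|edges sidon_graph|)%N.
Proof.
(* One edge is chosen from each square, the one between copies 0 and 2. Since squares share no
   edges, these are distinct. *)
pose e (p : Gamma * Gamma) :=
  [set block p.1 p.2 ord0; block p.1 p.2 (inord 2)]%SET.
have mem_e p : e p \in square p.1 p.2.
  by apply/imsetP; exists (ord0, inord 2); rewrite // inE /side /= inordK.
rewrite -cardsT -cardsX -(@card_in_imset _ _ e).
  apply/subset_leq_card/fintype.subsetP=> f /imsetP[[x a] /setXP[_ Aa] ->].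
  by apply/mem_edgesP; exists x, a; split=> //; exact: (mem_e (x, a)).
move=> [x a] [y b] /setXP[_ Aa] /setXP[_ Ab] exy.
have := mem_e (y, b); rewrite -exy => /(square_inj Aa Ab (mem_e (x, a))).
by case=> /= -> ->.
Qed.

Lemma card_edges_le : (#|edges sidon_graph| <= 16 * (#|Gamma| * #|A|))%N.
Proof.
(* A crude count suffices: an edge is given by its square and one of the 16 ordered pairs of
   copies. *)
pose e (p : ('I_4 * 'I_4) * (Gamma * Gamma)) :=
  [set block p.2.1 p.2.2 p.1.1; block p.2.1 p.2.2 p.1.2]%SET.
pose D := finset.setX [set: 'I_4 * 'I_4]%SET (finset.setX [set: Gamma]%SET A).
have -> : (16 * (#|Gamma| * #|A|) = #|D|)%N.
  by rewrite !cardsX !cardsT card_prod card_ord.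
apply: leq_trans (leq_imset_card e D).
apply/subset_leq_card/fintype.subsetP => f.
case/mem_edgesP=> x [a [Aa /imsetP[ij _ ->]]].
by apply/imsetP; exists (ij, (x, a)) => //; rewrite !inE.
Qed.

End Sidon.

Theorem theorem7p1 (R : realType) (c : R) (NN : set nat) :
  0 < c ->
  (forall N : nat, NN N -> (0 < N)%N) ->
  (forall N : nat, NN N ->
    exists (Gamma : finZmodType) (A : {set Gamma}),
      [/\ #|Gamma| = N,
          fold_sidon 3 [set x : Gamma | x \in A]%classic
        & c * Num.sqrt (N%:R : R) <= (#|A|)%:R]) ->
  exists C1 C2 : R,
    [/\ 0 < C1, 0 < C2
      & forall N : nat, NN N ->
          exists (V : finType) (G : sgraph V),
            [/\ #|V| = (4 * N)%N,
                C1 * (N%:R `^ (3 / 2)) <= (#|edges G|)%:R,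
                (#|edges G|)%:R <= C2 * (N%:R `^ (3 / 2))
              & forall f : {set V}, f \in edges G ->
                  exists! C : {set {set V}}, four_cycle G C /\ f \in C]].
Proof.
(* The edge count lies between [N * #|A|] and [16 * N * #|A|], while [#|A|] lies between
   [c * sqrt N] and [sqrt N]. This gives the constants [c] and 16. *)
move=> c_gt0 NN_gt0 sidonN; exists c, 16; split=> // N NNN.
have [Gamma [A [cardN sidonA cA]]] := sidonN N NNN.
have powN : N%:R `^ (3 / 2) = N%:R * Num.sqrt (N%:R : R).
  have N_gt0 : 0 < N%:R :> R by rewrite ltr0n NN_gt0.
  have -> : 3 / 2 = 1 + 2^-1 :> R by lra.
  by rewrite powRD ?lt0r_neq0 ?implybT // powRr1 ?ltW // powR12_sqrt ?ltW.
have A_le : #|A|%:R <= Num.sqrt N%:R :> R.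
  rewrite -[#|A|%:R]ger0_norm // -sqrtr_sqr ler_sqrt // -natrX ler_nat -cardN.
  exact: sidon_card sidonA.
exists ('I_4 * Gamma)%type, (sidon_graph A); split.
- by rewrite card_prod card_ord cardN.
- rewrite powN mulrCA; apply: le_trans (ler_wpM2l _ cA) _ => //.
  by rewrite -natrM ler_nat -cardN; apply: card_edges_ge.
- rewrite powN; apply: (@le_trans _ _ (16 * (N%:R * #|A|%:R))).
    by rewrite -!natrM ler_nat -cardN; apply: card_edges_le.
  by rewrite !ler_wpM2l.
- exact: edges_unique_four_cycle.
Qed.
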